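(* Let $\mathcal{M}=X_0,X_1,\dots$ be a reversible Markov chain on a state space $\Sigma$ with a stationary distribution $\pi$ (reversibility being a property of the transition probabilities with respect to $\pi$; the initial state $X_0$ need not be distributed as $\pi$), and let $\omega:\Sigma\to\mathbb{R}$ be an arbitrary real-valued labeling of the states. Let $\varepsilon>0$ and $\varepsilon_1\geq 0$. If the distribution $\rho$ of $X_0$ satisfies $\|\rho-\pi\|_{\mathrm{TV}}\leq\varepsilon_1$, then for any fixed integer $k\geq 0$, the probability that $\omega(X_0)$ is an $\varepsilon$-outlier among the list $\omega(X_0),\omega(X_1),\dots,\omega(X_k)$ is at most $\sqrt{2\varepsilon}+\varepsilon_1$.
   Context: A Markov chain on a (countable) state space $\Sigma$ is a time-homogeneous sequence $X_0,X_1,\dots$ of $\Sigma$-valued random variables, described by the distribution of $X_0$ and the transition probabilities. A distribution $\pi$ is stationary for the transition probabilities if $X_0\sim\pi$ implies $X_1\sim\pi$. The transition probabilities are reversible with respect to $\pi$ if, when the chain is started from $X_0\sim\pi$, for all $i,k$ the sequence $(X_i,X_{i+1},\dots,X_{i+k})$ has the same distribution as $(X_{i+k},X_{i+k-1},\dots,X_i)$. The chain is not assumed to be irreducible or mixing. The total variation distance between probability distributions $\rho_1,\rho_2$ on a probability space $\Omega$ is $\|\rho_1-\rho_2\|_{\mathrm{TV}}:=\sup_{E\subseteq\Omega}|\rho_1(E)-\rho_2(E)|$. A real number $\alpha_0$ is an $\varepsilon$-outlier among $\alpha_0,\alpha_1,\dots,\alpha_k$ if there are at most $\varepsilon(k+1)$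 indices $i\in\{0,1,\dots,k\}$ for which $\alpha_i\leq\alpha_0$ (the index $i=0$ is counted). *)

(* Defs.v *)
(* A countable state space is a measurable type [S] that is countable and on
   which every set is measurable; these two hypotheses are made where the
   definitions below are used. *)
From mathcomp Require Export all_boot all_order all_algebra.
From mathcomp Require Export all_classical all_reals all_analysis.

Set Implicit Arguments.
Unset Strict Implicit.
Unset Printing Implicit Defensive.

Import Order.TTheory GRing.Theory Num.Theory.
Local Open Scope classical_set_scope.
Local Open Scope ring_scope.
Local Open Scope ereal_scope.

Definition has_law dT dS (T : measurableType dT) (S : measurableType dS)
    (R : realType) (P : probability T R) (X : {RV P >-> S})
    (mu : probability S R) : Prop :=
  forall A : set S, measurable A -> distribution P X A = mu A.

(* The product form of
     P(X_n.+1 = x_n.+1 | X_0 = x_0, ..., X_n = x_n) = K x_n {x_n.+1},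
   which imposes nothing when the conditioning event is null. The kernel does
   not depend on [n] (time-homogeneity) and is unconstrained by the law of
   [X 0]. *)
Definition markov_chain dT dS (T : measurableType dT) (S : measurableType dS)
    (R : realType) (K : R.-pker S ~> S) (P : probability T R)
    (X : nat -> {RV P >-> S}) : Prop :=
  forall (n : nat) (x : nat -> S),
    P [set w | forall j, (j <= n.+1)%N -> X j w = x j] =
    P [set w | forall j, (j <= n)%N -> X j w = x j] * K (x n) [set x n.+1].

(* Stationarity and reversibility are properties of the transition kernel [K]
   with respect to [pi]; they quantify over all chains, on any probability
   space, with kernel [K] and started from [pi]. *)
Definition stationary dS (S : measurableType dS) (R : realType)
    (K : R.-pker S ~> S) (pi : probability S R) : Prop :=
  forall dT (T : measurableType dT) (P : probability T R)
      (X : nat -> {RV P >-> S}),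
    markov_chain K X -> has_law (X 0%N) pi -> has_law (X 1%N) pi.

(* [X_ i, ..., X_(i + k)] as a sequence of length [k.+1]. *)
Definition segment dT dS (T : measurableType dT) (S : measurableType dS)
    (R : realType) (P : probability T R) (X : nat -> {RV P >-> S})
    (i k : nat) (w : T) : seq S :=
  [seq X j w | j <- iota i k.+1].

(* The segment and its reversal have the same distribution. The set [A] of
   sequences is arbitrary: over a countable discrete [S] the segment takes
   countably many values, so both events are measurable. *)
Definition reversible dS (S : measurableType dS) (R : realType)
    (K : R.-pker S ~> S) (pi : probability S R) : Prop :=
  forall dT (T : measurableType dT) (P : probability T R)
      (X : nat -> {RV P >-> S}),
    markov_chain K X -> has_law (X 0%N) pi ->
    forall (i k : nat) (A : set (seq S)),
      P [set w | A (segment X i k w)] = P [set w | A (rev (segment X i k w))].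

Definition tv_dist d (S : measurableType d) (R : realType)
    (rho1 rho2 : probability S R) : \bar R :=
  ereal_sup [set `|rho1 E - rho2 E| | E in [set E : set S | measurable E]].

Definition outlier (R : realType) (eps : R) (k : nat) (a : 'I_k.+1 -> R) :
    Prop :=
  (#|[pred i : 'I_k.+1 | (a i <= a ord0)%R]|%:R <= eps * k.+1%:R)%R.

(* Main.v *)
(** With [m] the stationary weights, let [B x] be the probability that a path
    of length [k] started at [x] exhibits [x] as an outlier. For the stationary
    path [Y 0, ..., Y k] and any [j <= k], reversibility makes the two halves
    [Y j, ..., Y 0] and [Y j, ..., Y k] independent paths given [Y j]; if each
    of them, extended to length [k], exhibits [Y j] as an outlier, then [Y j]
    has rank at most [2 eps (k + 1)] in the whole path. By Cauchy-Schwarz this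
    has probability at least [(sum m B)^2] for each [j], while at most
    [2 eps (k + 1)] indices can have so low a rank; averaging over [j] gives
    [sum m B <= sqrt (2 eps)]. Starting from [rho] instead costs at most the
    total variation distance.

    As reversibility quantifies over chains, detailed balance can only be read
    off an actual chain with kernel [K] and initial law [pi]; one is built on
    the unit interval. *)
From HB Require Import structures.
Require Import Defs.
From mathcomp Require Import all_boot all_order all_algebra.
From mathcomp Require Import all_classical all_reals all_analysis.
From mathcomp Require Import measurable_realfun lra.

Set Implicit Arguments.
Unset Strict Implicit.
Unset Printing Implicit Defensive.

Import Order.TTheory GRing.Theory Num.Theory.
Local Open Scope classical_set_scope.
Local Open Scope ring_scope.
Local Open Scope ereal_scope.

(** * Sums over paths *)

(** Finite partial sums give one inequality. The other is the same inequality for [c^-1], with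
    [c = 0] treated apart. *)
Lemma esumZl (R : realType) (I : choiceType) (A : set I) (c : R)
    (f : I -> \bar R) : (0 <= c)%R -> (forall i, 0 <= f i) ->
  \esum_(i in A) (c%:E * f i) = c%:E * \esum_(i in A) f i.
Proof.
move=> c0 f0.
have le_scale (d : R) (g : I -> \bar R) : (0 <= d)%R -> (forall i, 0 <= g i) ->
    \esum_(i in A) (d%:E * g i) <= d%:E * \esum_(i in A) g i.
  move=> d0 g0; apply: ge_ereal_sup => _ [X [finX XA] <-].
  rewrite -ge0_mule_fsumr//; apply: lee_wpmul2l; first by rewrite lee_fin.
  by apply: ereal_sup_ubound; exists X.
apply/eqP; rewrite eq_le le_scale//=.
have [->|c_neq0] := eqVneq c 0%R.
  by rewrite mul0e esum_ge0// => i _; rewrite mul0e.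
have cV0 : (0 <= c^-1)%R by rewrite invr_ge0.
have := @le_scale c^-1%R (fun i => c%:E * f i) cV0.
under eq_esum do rewrite muleA -EFinM mulVf// mul1e.
move=> /(_ (fun i => mule_ge0 (c0 : 0 <= c%:E) (f0 i))) h.
rewrite -[leRHS]mul1e -(mulfV c_neq0) EFinM -muleA.
by apply: lee_wpmul2l; rewrite ?lee_fin.
Qed.

Lemma exchange_esum (R : realType) (I J : choiceType) (a : I -> J -> \bar R) :
  (forall i j, 0 <= a i j) ->
  \esum_(i in [set: I]) \esum_(j in [set: J]) a i j =
  \esum_(j in [set: J]) \esum_(i in [set: I]) a i j.
Proof.
move=> a0; rewrite !esum_esum//.
rewrite (reindex_esum ([set: J] `*` [set: I]) _ (fun z => (z.2, z.1)))//.
split=> //= [[i j] [i' j'] _ _ [-> ->]//|[i j] _].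
by exists (j, i).
Qed.

(** The averaging over the positions of a path rests on this count. Repeated states count once per
    position. *)
Lemma count_low_rank (R : realType) (S : eqType) (omega : S -> R) (x0 : S)
    (s : seq S) (c : R) : (0 <= c)%R ->
  (\sum_(i < size s)
     ((count (fun z => omega z <= omega (nth x0 s i)) s)%:R <= c)%R%:R <= c :> R)%R.
Proof.
move=> c0; pose J := [pred i : 'I_(size s) |
  (count (fun z => omega z <= omega (nth x0 s i)) s)%:R <= c]%R.
rewrite -natr_sum -big_mkcond/= sum1_card.
(* The [omega]-largest index [i] in [J] dominates all others, so their number
   is at most the rank of [i]. *)
have [/existsP[i0 Ji0]|J0] := boolP [exists i, J i]; last first.
  rewrite eq_card0 // => i; apply/negbTE/negP => Ji.
  by move/existsPn : J0 => /(_ i)/negP; apply.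
have [i Ji imax] := arg_maxP (fun i : 'I_(size s) => omega (nth x0 s i)) Ji0.
apply: (le_trans _ Ji); rewrite ler_nat.
rewrite -[X in count _ X](mkseq_nth x0 s) count_map -val_enum_ord count_map.
rewrite cardE size_filter -enumT; apply: sub_count => j Jj /=.
exact: imax.
Qed.

Section path_sums.
Context (R : realType) (S : choiceType).
Variable k : S -> S -> R.
Hypothesis k_ge0 : forall x y, (0 <= k x y)%R.

(* Expectation of [g] over the [n] steps following the state [x]. *)
Fixpoint path_sum (n : nat) (x : S) (g : seq S -> \bar R) : \bar R :=
  if n is n'.+1 then
    \esum_(y in [set: S]) ((k x y)%:E * path_sum n' y (fun r => g (y :: r)))
  else g [::].

Lemma path_sum_ge0 n x g : (forall r, 0 <= g r) -> 0 <= path_sum n x g.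
Proof.
elim: n x g => [|n IH] x g g0 //=.
by apply: esum_ge0 => y _; apply: mule_ge0; rewrite ?lee_fin// IH.
Qed.

Lemma le_path_sum n x g h : (forall r, size r = n -> g r <= h r) ->
  path_sum n x g <= path_sum n x h.
Proof.
elim: n x g h => [|n IH] x g h gh /=; first exact: gh.
apply: le_esum => y _; apply: lee_wpmul2l; first by rewrite lee_fin.
by apply: IH => r rn; apply: gh; rewrite /= rn.
Qed.

Lemma eq_path_sum n x g h : (forall r, size r = n -> g r = h r) ->
  path_sum n x g = path_sum n x h.
Proof.
by move=> gh; apply/eqP; rewrite eq_le !le_path_sum// => r /gh ->.
Qed.

Lemma path_sumZl n x (c : R) g : (0 <= c)%R -> (forall r, 0 <= g r) ->
  path_sum n x (fun r => c%:E * g r) = c%:E * path_sum n x g.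
Proof.
move=> c0; elim: n x g => [|n IH] x g g0 //=.
rewrite -esumZl//; last first.
  by move=> y; apply: mule_ge0; rewrite ?lee_fin// path_sum_ge0.
by apply: eq_esum => y _; rewrite IH// muleCA.
Qed.

Lemma path_sum_esum n x (h : seq S -> S -> \bar R) :
  (forall r z, 0 <= h r z) ->
  path_sum n x (fun r => \esum_(z in [set: S]) h r z) =
  \esum_(z in [set: S]) path_sum n x (h ^~ z).
Proof.
elim: n x h => [|n IH] x h h0 //=.
rewrite exchange_esum; last first.
  by move=> *; apply: mule_ge0; rewrite ?lee_fin// path_sum_ge0.
apply: eq_esum => y _; rewrite IH// esumZl// => z.
exact: path_sum_ge0.
Qed.

Lemma path_sum_sum n x (I : finType) (h : I -> seq S -> \bar R) :
  (forall i r, 0 <= h i r) ->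
  \sum_(i : I) path_sum n x (h i) = path_sum n x (fun r => \sum_(i : I) h i r).
Proof.
elim: n x h => [|n IH] x h h0 //=.
rewrite -esum_sum; last first.
  by move=> *; apply: mule_ge0; rewrite ?lee_fin// path_sum_ge0.
apply: eq_esum => y _; rewrite -ge0_sume_distrr ?IH// => i _.
exact: path_sum_ge0.
Qed.

Hypothesis k_le1 : forall x, \esum_(y in [set: S]) (k x y)%:E <= 1.

Lemma path_sum_cst n x (c : R) : (0 <= c)%R ->
  path_sum n x (fun=> c%:E) <= c%:E.
Proof.
move=> c0; elim: n x => [|n IH] x //=.
apply: (@le_trans _ _ (\esum_(y in [set: S]) (c%:E * (k x y)%:E))).
  by apply: le_esum => y _; rewrite muleC; apply: lee_wpmul2r; rewrite ?lee_fin.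
rewrite esumZl//; last by move=> y; rewrite lee_fin.
by rewrite -[leRHS]mule1; apply: lee_wpmul2l; rewrite ?lee_fin.
Qed.

(** Once the first [i] steps are fixed, the other [j] steps integrate a constant, which rows of mass
    at most one cannot increase. *)
Lemma path_sum_take i j x (g : seq S -> R) : (forall r, (0 <= g r)%R) ->
  path_sum (i + j) x (fun r => (g (take i r))%:E) <=
  path_sum i x (fun r => (g r)%:E).
Proof.
elim: i x g => [|i IH] x g g0.
  under eq_path_sum do rewrite take0.
  exact: path_sum_cst.
rewrite addSn /=; apply: le_esum => y _.
by apply: lee_wpmul2l; rewrite ?lee_fin// IH.
Qed.

Variable m : S -> R.
Hypothesis m_ge0 : forall x, (0 <= m x)%R.
Hypothesis m_le1 : \esum_(x in [set: S]) (m x)%:E <= 1.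
Hypothesis balance : forall x y, (m x * k x y = m y * k y x)%R.

(* Seen from its state number [i], a stationary path is a pair of independent
   paths running backward and forward in time. *)
Lemma path_sum_split i j (h : seq S -> S -> seq S -> \bar R) :
  (forall l x r, 0 <= h l x r) ->
  \esum_(x in [set: S]) ((m x)%:E *
    path_sum i x (fun l => path_sum j x (fun r => h l x r))) =
  \esum_(x in [set: S]) ((m x)%:E *
    path_sum (i + j) x (fun s =>
      h (rev (take i (x :: s))) (nth x (x :: s) i) (drop i s))).
Proof.
elim: i j h => [|i IH] j h h0.
  apply: eq_esum => x _; congr (_ * _); rewrite /= add0n.
  by apply: eq_path_sum => r _; rewrite drop0.
(* The induction moves the centre one step forward: the first state [x] after [y] becomes the centre
   and [y] joins the backward path. The value on [[::]] is a default, since forward paths here have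
   length [j.+1]. *)
pose h1 l y s := if s is x :: r then h (y :: l) x r else 0.
have h1_ge0 l x r : 0 <= h1 l x r by case: r => /=.
transitivity (\esum_(x in [set: S]) ((m x)%:E *
    path_sum i x (fun l => path_sum j.+1 x (fun r => h1 l x r)))); last first.
  rewrite IH//; apply: eq_esum => x _; congr (_ * _).
  rewrite addnS -addSn; apply: eq_path_sum => s /= ss.
  have ltis : (i < size s)%N by rewrite ss ltnS leq_addr.
  rewrite (drop_nth x ltis) /h1 -rev_rcons -take_nth// /= ltnS.
  exact: ltnW.
transitivity (\esum_(x in [set: S]) \esum_(y in [set: S])
    ((m x * k x y)%:E * path_sum i y (fun l => path_sum j x (h (y :: l) x)))).
  apply: eq_esum => x _ /=; rewrite -esumZl//; last first.
    move=> y; apply: mule_ge0; rewrite ?lee_fin// path_sum_ge0// => l.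
    exact: path_sum_ge0.
  by apply: eq_esum => y _; rewrite EFinM muleA.
rewrite exchange_esum; last first.
  move=> x y; apply: mule_ge0; first by rewrite lee_fin mulr_ge0.
  by apply: path_sum_ge0 => l; apply: path_sum_ge0.
apply: eq_esum => y _ /=; rewrite path_sum_esum; last first.
  by move=> *; apply: mule_ge0; rewrite ?lee_fin// path_sum_ge0.
rewrite -esumZl//; last first.
  move=> x; apply: path_sum_ge0 => l.
  by apply: mule_ge0; rewrite ?lee_fin// path_sum_ge0.
apply: eq_esum => x _.
rewrite path_sumZl//; last by move=> l; apply: path_sum_ge0.
(* Detailed balance turns the backward step from [x] to [y] into a forward step from [y] to [x]. *)
by rewrite muleA -EFinM balance.
Qed.

(** Cauchy-Schwarz, by summing [0 <= m x * (b x - p) ^+ 2] over [x]; the total mass of [m] is at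
    most one. *)
Lemma esum_square_ge (b : S -> R) (p : R) : (0 <= p)%R ->
  (forall x, (0 <= b x)%R) ->
  \esum_(x in [set: S]) ((m x)%:E * (b x)%:E) = p%:E ->
  (p ^+ 2)%:E <= \esum_(x in [set: S]) ((m x)%:E * (b x ^+ 2)%:E).
Proof.
move=> p0 b0 bp; set q := esum _ _.
have le_sum : (2 * p * p)%:E <= q + (p ^+ 2)%:E.
  rewrite EFinM -bp -esumZl; last first.
  - by move=> x; apply: mule_ge0; rewrite lee_fin.
  - by rewrite mulr_ge0.
  apply: (@le_trans _ _ (\esum_(x in [set: S])
      ((m x)%:E * (b x ^+ 2)%:E + (p ^+ 2)%:E * (m x)%:E))).
    apply: le_esum => x _; rewrite -!EFinM -EFinD lee_fin.
    have := mulr_ge0 (m_ge0 x) (sqr_ge0 (b x - p)); lra.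
  rewrite esumD; last 2 first.
  - by move=> x _; apply: mule_ge0; rewrite lee_fin// sqr_ge0.
  - by move=> x _; apply: mule_ge0; rewrite lee_fin// sqr_ge0.
  apply: leeD => //; rewrite esumZl ?sqr_ge0//.
  by rewrite -[leRHS]mule1; apply: lee_wpmul2l; rewrite ?lee_fin ?sqr_ge0.
rewrite -(leeD2rE (x := (p ^+ 2)%:E))// -EFinD.
by apply: le_trans le_sum; rewrite lee_fin; lra.
Qed.

(** * Outliers on stationary paths *)

Variable omega : S -> R.

(** Here [r] holds the states after [x]; the successor accounts for [x] itself. *)
Let low (c : R) x (r : seq S) : R :=
  ((count (fun z => omega z <= omega x) r).+1%:R <= c)%R%:R.

Theorem outlier_path_sum (eps : R) n : (0 < eps)%R ->
  \esum_(x in [set: S]) ((m x)%:E *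
     path_sum n x (fun r => (low (eps * n.+1%:R) x r)%:E))
  <= (Num.sqrt (2 * eps))%:E.
Proof.
move=> eps0; set c := (eps * n.+1%:R)%R.
have c0 : (0 <= c)%R by rewrite mulr_ge0// ltW.
have c20 : (0 <= 2 * c)%R by apply: mulr_ge0.
have low_ge0 d x r : (0 <= low d x r)%R by exact: ler0n.
have low_le1 d x r : (low d x r <= 1)%R by rewrite /low lern1 leq_b1.
have low_sum_fin i x :
    exists2 d, (0 <= d <= 1)%R & path_sum i x (fun r => (low c x r)%:E) = d%:E.
  set t := path_sum _ _ _.
  have t0 : 0 <= t by apply: path_sum_ge0 => r; rewrite lee_fin.
  have t1 : t <= 1.
    apply: le_trans (@path_sum_cst i x 1%R _) => //.
    by apply: le_path_sum => r _; rewrite lee_fin.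
  have tE : t = (fine t)%:E.
    by rewrite fineK// ge0_fin_numE// (le_lt_trans t1)// ltry.
  by exists (fine t); rewrite // -!lee_fin -tE t0.
pose b x := fine (path_sum n x (fun r => (low c x r)%:E)).
have bE x : path_sum n x (fun r => (low c x r)%:E) = (b x)%:E.
  by rewrite /b; have [d _ ->] := low_sum_fin n x.
have b01 x : (0 <= b x <= 1)%R.
  by rewrite /b; have [d d01 ->] := low_sum_fin n x.
have b0 x : (0 <= b x)%R by case/andP: (b01 x).
have b1 x : (b x <= 1)%R by case/andP: (b01 x).
under eq_esum do rewrite bE.
set s := esum _ _.
have s0 : 0 <= s by apply: esum_ge0 => x _; rewrite mule_ge0 ?lee_fin.
have s1 : s <= 1.
  apply: le_trans m_le1; apply: le_esum => x _.
  by rewrite -[leRHS]mule1; apply: lee_wpmul2l; rewrite ?lee_fin.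
have [p sp] : exists p : R, s = p%:E.
  exists (fine s); rewrite fineK// ge0_fin_numE//.
  by apply: le_lt_trans s1 _; exact: ltry.
have p0 : (0 <= p)%R by rewrite -lee_fin -sp.
have p2q := esum_square_ge p0 b0 sp.
(* It remains to bound [p ^+ 2] by [2 * eps]. *)
rewrite sp lee_fin -(ger0_norm p0) -sqrtr_sqr; apply: ler_wsqrtr.
(* Each [q i] will be at least [p ^+ 2], while the sum of the [n.+1] of them is at most [2 * c]. *)
pose f (i : nat) x l :=
  ((count (fun z => omega z <= omega (nth x (x :: l) i)) (x :: l))%:R
    <= 2 * c)%R%:R : R.
pose q (i : nat) := \esum_(x in [set: S]) ((m x)%:E *
  path_sum n x (fun l => (f i x l)%:E)).
have pq (i : 'I_n.+1) : (p ^+ 2)%:E <= q i.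
  apply: (le_trans p2q).
  have niE : (i + (n - i))%N = n by rewrite subnKC// -ltnS.
  (* Given the centre [x] the two halves are independent, so the inner sum factors; each factor is
     at least [b x]. *)
  apply: (@le_trans _ _ (\esum_(x in [set: S]) ((m x)%:E *
      path_sum i x (fun l => path_sum (n - i) x (fun r =>
        (low c x l * low c x r)%:E))))).
    apply: le_esum => x _; apply: lee_wpmul2l; first by rewrite lee_fin.
    (* Truncating a path can only lower the count, while the threshold [c] stays that of length
       [n]. *)
    have le_low i' j' : (i' + j')%N = n ->
        (b x)%:E <= path_sum i' x (fun r => (low c x r)%:E).
      move=> ijn; rewrite -bE.
      rewrite (_ : path_sum n = path_sum (i' + j')); last by rewrite ijn.
      apply: le_trans (path_sum_take _ _ _ _) => //.
      apply: le_path_sum => r _; rewrite lee_fin /low ler_nat.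
      case: (boolP (_.+1%:R <= c)%R) => // h.
      rewrite (le_trans _ h)// ler_nat ltnS -{2}(cat_take_drop i' r) count_cat.
      exact: leq_addr.
    rewrite expr2 EFinM.
    have -> : path_sum i x (fun l => path_sum (n - i) x (fun r =>
        (low c x l * low c x r)%:E)) =
      path_sum i x (fun l => (low c x l)%:E) *
      path_sum (n - i) x (fun r => (low c x r)%:E).
      have [d /andP[d0 _] dE] := low_sum_fin (n - i)%N x.
      rewrite dE muleC -path_sumZl//; last by move=> r; rewrite lee_fin.
      apply: eq_path_sum => l _.
      under eq_path_sum do rewrite EFinM.
      rewrite path_sumZl//; last by move=> r; rewrite lee_fin.
      by rewrite dE muleC.
    apply: lee_pmul; [by rewrite lee_fin|by rewrite lee_fin| |].
      exact: le_low niE.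
    by apply: (le_low _ i); rewrite addnC.
  (* Each half counts the centre for itself, the joined path counts it once, so its rank there is at
     most [2 * c - 1]. *)
  apply: (@le_trans _ _ (\esum_(x in [set: S]) ((m x)%:E *
      path_sum i x (fun l => path_sum (n - i) x (fun r =>
        ((count (fun z => omega z <= omega x) (l ++ x :: r))%:R
          <= 2 * c)%R%:R%:E))))).
    apply: le_esum => x _; apply: lee_wpmul2l; first by rewrite lee_fin.
    apply: le_path_sum => l _; apply: le_path_sum => r _.
    rewrite lee_fin /low -natrM ler_nat count_cat /= lexx.
    case: (boolP (_.+1%:R <= c)%R) => // hl.
    case: (boolP (_.+1%:R <= c)%R) => // hr.
    rewrite muln1 lt0b mulr_natl mulr2n; apply: le_trans (lerD hl hr).
    by rewrite -natrD ler_nat add1n leq_add2r leqnSn.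
  rewrite path_sum_split; last by move=> *; rewrite lee_fin.
  rewrite niE; apply: le_esum => x _.
  apply: lee_wpmul2l; first by rewrite lee_fin.
  apply: le_path_sum => l ln; rewrite lee_fin /f.
  have lti : (i < size (x :: l))%N by rewrite /= ln.
  (* Undoing the reversal of the first half restores the path [x :: l], and counts ignore order. *)
  rewrite count_cat count_rev -[X in (_ + X)%N]/(count _ (nth x (x :: l) i :: _)).
  rewrite -[drop i l]/(drop i.+1 (x :: l)) -drop_nth// -count_cat.
  by rewrite cat_take_drop.
(* After exchanging the sums, [count_low_rank] applies to each path separately. *)
have q_le : \sum_(i < n.+1) q i <= (2 * c)%:E.
  rewrite -esum_sum; last first.
    by move=> *; rewrite mule_ge0 ?lee_fin// path_sum_ge0// => r; rewrite lee_fin.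
  apply: (@le_trans _ _ (\esum_(x in [set: S]) ((2 * c)%:E * (m x)%:E))).
    apply: le_esum => x _; rewrite -ge0_sume_distrr; last first.
      by move=> *; rewrite path_sum_ge0// => r; rewrite lee_fin.
    rewrite path_sum_sum; last by move=> *; rewrite lee_fin.
    rewrite muleC; apply: lee_wpmul2r; first by rewrite lee_fin.
    apply: le_trans (path_sum_cst n x _); last exact: c20.
    apply: le_path_sum => l ln; rewrite sumEFin lee_fin.
    have := @count_low_rank _ _ omega x (x :: l) (2 * c)%R.
    by rewrite /= ln; apply; exact: c20.
  rewrite esumZl//.
  by rewrite -[leRHS]mule1; apply: lee_wpmul2l; rewrite ?lee_fin.
have : (p ^+ 2 *+ n.+1)%:E <= (2 * c)%:E.
  apply: le_trans q_le; rewrite -{1}[n.+1]card_ord -sumr_const -sumEFin.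
  by apply: lee_sum => i _; exact: pq.
by rewrite lee_fin -mulr_natr /c mulrA ler_pM2r// ltr0n.
Qed.
End path_sums.

(** * Path probabilities of a Markov chain *)

Lemma bigcup_fibers (T S : Type) (f : T -> S) (A : set T) :
  A = \bigcup_(s in [set: S]) (A `&` f @^-1` [set s]).
Proof.
apply/seteqP; split => [w Aw|w [s _ [//]]].
by exists (f w).
Qed.

(** Countable additivity: an injection [e] of [S] into [nat] turns the fibres into a sequence of
    disjoint sets, empty at indices outside the image of [e]. *)
Lemma measure_fibers d (T : measurableType d) (R : realType)
    (mu : {measure set T -> \bar R}) (S : choiceType) (f : T -> S) (A : set T) :
  countable [set: S] ->
  (forall s, measurable (A `&` f @^-1` [set s])) ->
  mu A = \esum_(s in [set: S]) mu (A `&` f @^-1` [set s]).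
Proof.
move=> /countable_injP[e e_inj] mAf.
have e_injT : injective e by move=> x y /e_inj; apply; rewrite inE.
pose F n := A `&` (e \o f) @^-1` [set n].
have FE s : F (e s) = A `&` f @^-1` [set s].
  by apply/seteqP; split => w [Aw fw]; split => //; [exact: e_injT|rewrite /= fw].
have F0 n : ~ (e @` [set: S]) n -> F n = set0.
  move=> en; apply/seteqP; split => // w [_ /= fw]; apply: en.
  by exists (f w).
have mF n : measurable (F n).
  have [[s _ <-]|/F0 ->] := pselect ((e @` [set: S]) n); last exact: measurable0.
  by rewrite FE.
have -> : mu A = mu (\bigcup_n F n) by rewrite -(bigcup_fibers (e \o f)).
rewrite measure_semi_bigcup//; last 2 first.
- apply/trivIsetP => i j _ _ /eqP ij; apply/seteqP; split => // w.
  by move=> [[_ /= wi] [_ /= wj]]; apply: ij; rewrite -wi.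
- exact: bigcup_measurable.
rewrite nneseries_esumT//.
under [RHS]eq_esum do rewrite -FE.
rewrite -(esum_image [set: S] e (fun n => mu (F n))).
  rewrite [RHS]esum_mkcond; apply: eq_esum => n _.
  by case: ifPn => // /negP; rewrite inE => /F0 ->; rewrite measure0.
by move=> x y _ _; exact: e_injT.
Qed.

Lemma measure_esum dS (S : measurableType dS) (R : realType)
    (S_countable : countable [set: S])
    (S_discrete : forall A : set S, measurable A)
    (mu : {measure set S -> \bar R}) (A : set S) :
  mu A = \esum_(x in A) mu [set x].
Proof.
rewrite (@measure_fibers _ _ _ _ _ id _ S_countable)//.
rewrite [RHS]esum_mkcond; apply: eq_esum => x _; case: ifPn => [|/negP];
  rewrite inE => Ax.
  by congr (mu _); apply/seteqP; split => y /= => [[]//|->].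
rewrite (_ : _ `&` _ = set0) ?measure0//.
by apply/seteqP; split => y //= [Ay yx]; apply: Ax; rewrite -yx.
Qed.

Section markov_paths.
Context (R : realType) dS (S : measurableType dS).
Hypothesis S_countable : countable [set: S].
Hypothesis S_discrete : forall A : set S, measurable A.

Definition transition (K : R.-pker S ~> S) (x y : S) : R := fine (K x [set y]).

Lemma EFin_transition K x y : (transition K x y)%:E = K x [set y].
Proof.
rewrite fineK// ge0_fin_numE// (@le_lt_trans _ _ 1) ?ltry//.
by rewrite -(prob_kernel (s := K) x) le_measure// inE.
Qed.

Lemma transition_ge0 K x y : (0 <= transition K x y)%R.
Proof. by rewrite fine_ge0// measure_ge0. Qed.

Context dT (T : measurableType dT) (P : probability T R).
Variable X : nat -> {RV P >-> S}.

Lemma measurable_RV_preimage n (A : set S) : measurable (X n @^-1` A).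
Proof.
rewrite -[_ @^-1` _]setTI; exact: (measurable_funPT (X n)).
Qed.

(** Splitting along the countably many values of [X i] leaves shorter trajectory events, whatever
    the set [A]. *)
Lemma measurable_trajectory i n (A : set (seq S)) :
  measurable [set w | A [seq X j w | j <- iota i n]].
Proof.
elim: n i A => [|n IH] i A.
  have [A0|A0] := pselect (A [::]).
    rewrite (_ : mkset _ = setT); first exact: measurableT.
    by apply/seteqP; split.
  rewrite (_ : mkset _ = set0); first exact: measurable0.
  by apply/seteqP; split.
rewrite (bigcup_fibers (X i) [set _ | _]).
apply: countable_bigcupT_measurable => // x.
rewrite (_ : _ `&` _ = [set w | A (x :: [seq X j w | j <- iota i.+1 n])] `&`
  X i @^-1` [set x]).
  apply: measurableI; last exact: measurable_RV_preimage.
  exact: (IH _ (A \o cons x)).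
by apply/seteqP; split => w [/= + wx]; rewrite wx.
Qed.

Lemma measurable_cylinder n (x : nat -> S) :
  measurable [set w | forall j, (j <= n)%N -> X j w = x j].
Proof.
rewrite (_ : [set _ | _] = \bigcap_(j in [set j | (j <= n)%N]) X j @^-1` [set x j]).
  by apply: bigcap_measurable => [|j _]; [exists 0%N|exact: measurable_RV_preimage].
by apply/seteqP; split => w /= h j; exact: h.
Qed.

Variable K : R.-pker S ~> S.
Hypothesis X_markov : markov_chain K X.

(** Induction on [m]: fixing the value of [X n.+1] lengthens the cylinder by one state, and the
    Markov property supplies the transition factor. *)
Lemma markov_cylinder_path n m (x : nat -> S) (A : pred (seq S)) :
  P ([set w | forall j, (j <= n)%N -> X j w = x j] `&`
     [set w | A [seq X j w | j <- iota n.+1 m]]) =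
  P [set w | forall j, (j <= n)%N -> X j w = x j] *
  path_sum (transition K) m (x n) (fun r => (A r)%:R%:E).
Proof.
elim: m n x A => [|m IH] n x A /=.
  case: (A [::]).
    by rewrite mule1; congr (P _); apply/seteqP; split => w // [].
  by rewrite mule0 -(measure0 P); congr (P _); apply/seteqP; split => w // [].
rewrite (@measure_fibers _ _ _ _ _ (X n.+1) _ S_countable); last first.
  move=> y; apply: measurableI; last exact: measurable_RV_preimage.
  apply: measurableI; first exact: measurable_cylinder.
  exact: (@measurable_trajectory n.+1 m.+1 A).
set c := P _.
have cE : c = (fine c)%:E.
  by rewrite fineK// fin_num_measure//; exact: measurable_cylinder.
rewrite [in RHS]cE -esumZl; last 2 first.
- by rewrite fine_ge0// measure_ge0.
- move=> y; apply: mule_ge0; first by rewrite lee_fin transition_ge0.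
  by apply: path_sum_ge0 => [u v|r]; rewrite ?transition_ge0 ?lee_fin.
apply: eq_esum => y _; rewrite -cE muleA EFin_transition.
(* [x'] prolongs the prescribed states by [y] at time [n.+1]; its later values are never read. *)
pose x' j := if (j <= n)%N then x j else y.
have x'E j : (j <= n)%N -> x' j = x j by rewrite /x' => ->.
have x'n : x' n.+1 = y by rewrite /x' ltnn.
have := X_markov n x'.
rewrite (_ : [set w | forall j, (j <= n)%N -> X j w = x' j] =
  [set w | forall j, (j <= n)%N -> X j w = x j]); last first.
  by apply/seteqP; split => w h j jn; rewrite h// x'E.
rewrite x'n x'E// => <-; rewrite -[in RHS]x'n.
rewrite -(IH n.+1 x' (fun r => A (x' n.+1 :: r))); congr (P _).
apply/seteqP; split => w /=.
  move=> [[wx Aw] wy]; split; last by rewrite x'n -wy.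
  move=> j; rewrite leq_eqVlt => /predU1P[->|jn]; first by rewrite x'n.
  by rewrite x'E// wx.
move=> [wx Aw]; have wy := wx _ (leqnn _); rewrite wy; split => //.
by split => // j jn; rewrite wx ?x'E// ltnW.
Qed.

Lemma markov_segment rho k (A : pred (seq S)) : has_law (X 0%N) rho ->
  P [set w | A (segment X 0 k w)] = \esum_(x in [set: S])
   (rho [set x] * path_sum (transition K) k x (fun r => (A (x :: r))%:R%:E)).
Proof.
move=> X0; rewrite (@measure_fibers _ _ _ _ _ (X 0%N) _ S_countable); last first.
  move=> x; apply: measurableI; last exact: measurable_RV_preimage.
  exact: (@measurable_trajectory 0 k.+1 A).
apply: eq_esum => x _.
have -> : rho [set x] = P [set w | forall j, (j <= 0)%N -> X j w = x].
  rewrite -X0//; congr (P _); apply/seteqP; split => w /= h.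
    by move=> j; rewrite leqn0 => /eqP ->.
  exact: h.
rewrite -(@markov_cylinder_path 0 k (fun=> x) (fun r => A (x :: r))).
congr (P _); apply/seteqP; split => w; rewrite /segment /=.
  by move=> [+ wx]; rewrite wx; split=> // j; rewrite leqn0 => /eqP ->.
by move=> [wx Aw]; have wx0 := wx 0%N isT; rewrite wx0.
Qed.

End markov_paths.

(** Only states in the set [E] where [rho] exceeds [pi] increase the sum. As [f <= 1], they add at
    most [rho E - pi E], hence at most the total variation distance. *)
Lemma le_esum_tv dS (S : measurableType dS) (R : realType)
    (S_countable : countable [set: S])
    (S_discrete : forall A : set S, measurable A)
    (rho pi : probability S R) (eps : R) (f : S -> \bar R) :
  tv_dist rho pi <= eps%:E -> (forall x, 0 <= f x <= 1) ->
  \esum_(x in [set: S]) (rho [set x] * f x) <=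
  \esum_(x in [set: S]) (pi [set x] * f x) + eps%:E.
Proof.
move=> tv f01.
have f0 x : 0 <= f x by case/andP: (f01 x).
have f1 x : f x <= 1 by case/andP: (f01 x).
have finS (mu : probability S R) A : mu A \is a fin_num.
  by rewrite fin_num_measure.
have massE (mu : probability S R) A : mu A = \esum_(x in A) mu [set x].
  exact: measure_esum.
pose E := [set x | pi [set x] < rho [set x]].
pose d x := if x \in E then rho [set x] - pi [set x] else 0.
have d0 x : 0 <= d x.
  by rewrite /d; case: ifPn => //; rewrite inE => /ltW; rewrite sube_ge0 ?finS.
apply: (@le_trans _ _ (\esum_(x in [set: S]) (pi [set x] * f x + d x))).
  apply: le_esum => x _; rewrite /d.
  case: ifPn => [|/negP]; rewrite inE => Ex; last first.
    move: Ex => /negP; rewrite -leNgt adde0 => h.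
    exact: lee_wpmul2r.
  have ffin : f x \is a fin_num.
    by rewrite ge0_fin_numE// (le_lt_trans (f1 x)) ?ltry.
  have := f1 x; rewrite -(fineK ffin) -(fineK (finS rho _)) -(fineK (finS pi _)).
  rewrite -!EFinM -EFinB -EFinD !lee_fin => f1x.
  have : (0 <= (fine (rho [set x]) - fine (pi [set x])) * (1 - fine (f x)))%R.
    rewrite mulr_ge0 ?subr_ge0// -lee_fin !fineK ?finS//.
    exact: ltW.
  lra.
rewrite esumD; [|by move=> x _; rewrite mule_ge0|by move=> x _; exact: d0].
(* With the finite [pi E] added on both sides, the differences over [E] recombine to [rho E]. *)
apply: leeD => //; rewrite -(leeD2rE (x := pi E)); last by rewrite finS.
rewrite [X in _ + X]massE {1}/d -esum_mkcond.
rewrite -esumD; [|move=> x|by move=> x _]; last first.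
  by rewrite /E /= => /ltW; rewrite sube_ge0 ?finS.
under eq_esum do rewrite subeK//.
rewrite -massE -leeBlDr; last by rewrite finS.
apply: le_trans tv; apply: le_trans (lee_abs _) _.
by apply: ereal_sup_ubound; exists E => //; exact: S_discrete.
Qed.

(** * A chain with given kernel and initial law *)

Lemma uniform_prob_itvco (R : realType) (a l : R) :
  (0 <= a)%R -> (0 <= l)%R -> (a + l <= 1)%R ->
  uniform_prob (@ltr01 R) `[a, (a + l)%R[ = l%:E.
Proof.
move=> a0 l0 al1; rewrite /uniform_prob.
under eq_integral => x.
  rewrite inE /= in_itv /= => /andP[ax xal].
  rewrite /uniform_pdf (le_trans a0 ax) (ltW (lt_le_trans xal al1)) subr0 invr1.
  over.
rewrite integral_cst//= mul1e lebesgue_measure_itv /= lte_fin -EFinD.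
have [->|l_neq0] := eqVneq l 0%R; first by rewrite addr0 ltxx.
by rewrite ltrDl lt_neqAle eq_sym l_neq0 l0/= addrC addKr.
Qed.

(** * Quantile functions on a countable set *)

Section quantile.
Context (R : realType) dS (S : measurableType dS).
Hypothesis S_discrete : forall A : set S, measurable A.
Variable e : S -> nat.
Hypothesis e_inj : injective e.
Variable s0 : S.

(** With states ordered by their code under [e], the slots of a probability law tile [[0, 1[]; a
    null state gets an empty slot. *)
Definition lower (mu : set S -> \bar R) (s : S) : R :=
  fine (mu [set t | (e t < e s)%N]).
Definition mass (mu : set S -> \bar R) (s : S) : R := fine (mu [set s]).
Definition slot (mu : set S -> \bar R) (s : S) : set R :=
  `[lower mu s, (lower mu s + mass mu s)%R[.
(* [s0] is the junk value outside the unit interval. *)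
Definition quantile (mu : set S -> \bar R) (u : R) : S :=
  xget s0 [set s | slot mu s u].
(** For a probability law and [u] in [[0, 1[] the divisor is positive, because the slot of
    [quantile mu u] contains [u]. *)
Definition residue (mu : set S -> \bar R) (u : R) : R :=
  ((u - lower mu (quantile mu u)) / mass mu (quantile mu u))%R.

Section one_law.
Variable mu : {measure set S -> \bar R}.
Hypothesis mu1 : mu [set: S] = 1.

Lemma law_fin A : mu A \is a fin_num.
Proof.
rewrite ge0_fin_numE// (@le_lt_trans _ _ 1) ?ltry//.
by rewrite -mu1 le_measure// inE.
Qed.

Lemma lower_ge0 s : (0 <= lower mu s)%R.
Proof. by rewrite fine_ge0// measure_ge0. Qed.

Lemma mass_ge0 s : (0 <= mass mu s)%R.
Proof. by rewrite fine_ge0// measure_ge0. Qed.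

Lemma EFin_slot_end s :
  (lower mu s + mass mu s)%:E = mu [set t | (e t <= e s)%N].
Proof.
rewrite EFinD !fineK ?law_fin// -measureU//.
  congr (mu _); apply/seteqP; split=> t /=.
    by case=> [/ltnW//|->].
  by rewrite leq_eqVlt => /predU1P[/e_inj|]; [right|left].
by apply/seteqP; split => // t [/= + ts]; rewrite ts ltnn.
Qed.

Lemma slot_end_le1 s : (lower mu s + mass mu s <= 1)%R.
Proof. by rewrite -lee_fin EFin_slot_end -mu1 le_measure// inE. Qed.

Lemma slot_end_le_lower s t : (e s < e t)%N ->
  (lower mu s + mass mu s <= lower mu t)%R.
Proof.
move=> st; rewrite -lee_fin EFin_slot_end fineK ?law_fin//.
by rewrite le_measure ?inE// => r /= /leq_ltn_trans; apply.
Qed.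

Lemma slot_inj u s t : slot mu s u -> slot mu t u -> s = t.
Proof.
wlog : s t / (e s <= e t)%N.
  by move=> wl; have [/wl//|/ltnW/wl wts ? ?] := leqP (e s) (e t); apply/esym/wts.
rewrite leq_eqVlt => /predU1P[/e_inj//|/slot_end_le_lower st].
rewrite /slot /= !in_itv /= => /andP[_ us] /andP[tu _].
by have := lt_le_trans us (le_trans st tu); rewrite ltxx.
Qed.

(** Continuity from below gives a least [k.+1] with [u < mu (F k.+1)]. The measure grows from [F k]
    to [F k.+1], so some state has code [k], and its slot contains [u]. *)
Lemma slot_exists u : (0 <= u < 1)%R -> exists s, slot mu s u.
Proof.
move=> /andP[u0 u1].
pose F n := [set t | (e t < n)%N].
have FT : \bigcup_n F n = setT.
  by apply/seteqP; split => // t _; exists (e t).+1 => //; exact: ltnSn.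
have [n nu] : exists n, u%:E < mu (F n).
  have cvgF : mu \o F @ \oo --> (1 : \bar R).
    rewrite -mu1 -FT; apply: nondecreasing_cvg_mu => // i j ij.
    by apply/subsetPset => t /leq_trans; exact.
  apply: contrapT => /forallNP nF.
  suff : 1 <= u%:E by rewrite lee_fin leNgt u1.
  apply: (cvge_le _ cvgF); apply: nearW => n /=.
  by rewrite leNgt; apply/negP/nF.
have [k ku kmin] := ex_minnP (ex_intro (fun n => u%:E < mu (F n)) n nu).
case: k => [|k] in ku kmin *.
  have F0 : F 0%N = set0 by apply/seteqP; split.
  by move: ku; rewrite F0 measure0 lte_fin ltNge u0.
have uk : mu (F k) <= u%:E.
  by rewrite leNgt; apply/negP => /kmin; rewrite ltnn.
have [s sk] : exists s, e s = k.
  apply: contrapT => /forallNP nk.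
  have : F k.+1 `<=` F k.
    move=> t; rewrite /F /= ltnS leq_eqVlt => /predU1P[tk|//].
    by have := nk t.
  move=> /(le_measure mu); rewrite !inE => /(_ (S_discrete _) (S_discrete _)).
  by move=> /(lt_le_trans ku) /lt_le_trans /(_ uk); rewrite ltxx.
exists s; rewrite /slot /= in_itv /= -lee_fin -lte_fin EFin_slot_end.
rewrite fineK ?law_fin// sk uk /=.
by rewrite (_ : [set t | _] = F k.+1).
Qed.

Lemma slot_itv s u : slot mu s u -> (0 <= u < 1)%R.
Proof.
rewrite /slot /= in_itv /= => /andP[su us].
by rewrite (le_trans (lower_ge0 s) su) (lt_le_trans us (slot_end_le1 s)).
Qed.

Lemma quantileE u s : (0 <= u < 1)%R -> quantile mu u = s <-> slot mu s u.
Proof.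
move=> /slot_exists [t tu]; split => [<-|su].
  exact: (@xgetI _ s0 [set s | slot mu s u] _ tu).
by apply: xget_unique => // r ru; exact: (slot_inj ru su).
Qed.

Lemma measurable_quantile_fiber s : measurable [set u | quantile mu u = s].
Proof.
(* Outside [[0, 1[] the quantile takes the junk value, so the fibre of [s0] also contains that
   complement. *)
have [ss0|ss0] := pselect (s = s0).
  rewrite (_ : mkset _ = slot mu s `|` ~` `[0%R, 1%R[).
    apply: measurableU; first exact: measurable_itv.
    by apply: measurableC; exact: measurable_itv.
  apply/seteqP; split => u /=; rewrite in_itv /=.
    have [u01|u01] := boolP (0 <= u < 1)%R; last by right; apply/negP.
    by move/(quantileE s u01); left.
  move=> [su|/negP u01]; first by apply/quantileE => //; exact: slot_itv su.
  rewrite ss0; apply: xgetPN => t /= /slot_itv; apply/negP.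
  by rewrite (negbTE u01).
rewrite (_ : mkset _ = slot mu s); first exact: measurable_itv.
apply/seteqP; split => u /=; last by move=> su; apply/quantileE => //; exact: slot_itv su.
have [u01|/negP u01] := boolP (0 <= u < 1)%R; first by move/(quantileE s u01).
move=> us; case: ss0; rewrite -us; apply: xgetPN => t /= /slot_itv.
exact: u01.
Qed.

Lemma measurable_quantile_residue s (A : set R) : measurable A ->
  measurable [set u | quantile mu u = s /\ A (residue mu u)].
Proof.
move=> mA.
(* On the fibre of [s] the residue agrees with the affine map [g]. *)
pose g u : R := ((u - lower mu s) / mass mu s)%R.
rewrite (_ : mkset _ = [set u | quantile mu u = s] `&` g @^-1` A).
  apply: measurableI; first exact: measurable_quantile_fiber.
  rewrite -[_ @^-1` _]setTI; apply: (_ : measurable_fun setT g) => //.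
  by apply: measurable_funM => //; apply: measurable_funB.
by apply/seteqP; split => u /= [us]; rewrite /residue us.
Qed.

End one_law.

(** * The chain driven by a single uniform seed *)

Section chain.
Variables (pi : probability S R) (K : R.-pker S ~> S).
Hypothesis S_countable : countable [set: S].

(* A uniform variable [u] selects the next state through the quantile
   function; conditionally on that state its position within the slot,
   rescaled, is again uniform and serves as the randomness for the next
   step. *)
Fixpoint run (n : nat) (u : R) : S * R :=
  if n is n'.+1 then
    let: (s, v) := run n' u in (quantile (K s) v, residue (K s) v)
  else (quantile pi u, residue pi u).

(** State and residue are treated jointly because the next step reads both. *)
Lemma measurable_run n s (A : set R) : measurable A ->
  measurable [set u | (run n u).1 = s /\ A (run n u).2].
Proof.
elim: n s A => [|n IH] s A mA /=.
  by apply: measurable_quantile_residue => //; exact: probability_setT.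
rewrite (bigcup_fibers (fun u => (run n u).1) (mkset _)).
apply: countable_bigcupT_measurable => // t.
have mB : measurable [set v | quantile (K t) v = s /\ A (residue (K t) v)].
  by apply: measurable_quantile_residue => //; exact: prob_kernel.
have := IH t _ mB; congr (measurable _); apply/seteqP; split=> u /=;
  by case: (run n u) => r v /=; case=> [+ []]; move=> *; subst.
Qed.

(** The seeds in [[0, 1[] whose run follows [x] up to time [n] form a half-open interval, with left
    end [cyl_lo x n] and length [cyl_len x n], the path probability. *)
Fixpoint cyl_len (x : nat -> S) (n : nat) : R :=
  if n is n'.+1 then (cyl_len x n' * mass (K (x n')) (x n))%R
  else mass pi (x 0%N).

Fixpoint cyl_lo (x : nat -> S) (n : nat) : R :=
  if n is n'.+1 then (cyl_lo x n' + cyl_len x n' * lower (K (x n')) (x n))%R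
  else lower pi (x 0%N).

Lemma cyl_bounds x n :
  [/\ 0 <= cyl_lo x n, 0 <= cyl_len x n & cyl_lo x n + cyl_len x n <= 1]%R.
Proof.
elim: n => [|n [lo0 len0 le1]] /=.
  split; [exact: lower_ge0|exact: mass_ge0|].
  by apply: slot_end_le1; exact: probability_setT.
have K1 := @prob_kernel _ _ _ _ _ K (x n).
have l0 := lower_ge0 (K (x n)) (x n.+1).
have m0 := mass_ge0 (K (x n)) (x n.+1).
have e1 := slot_end_le1 K1 (x n.+1).
split; [by rewrite addr_ge0// mulr_ge0|by rewrite mulr_ge0|].
by rewrite -addrA -mulrDr (le_trans _ le1)// lerD2l ler_piMr.
Qed.

(** On the interval for [n] the residue is [u] rescaled to [[0, 1[], so the slot of the next state
    cuts out the interval for [n.+1]. The formula for the residue is what carries the induction. *)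
Lemma run_cylinder x n u : (0 <= u < 1)%R ->
  ((forall j, (j <= n)%N -> (run j u).1 = x j) <->
   (cyl_lo x n <= u < cyl_lo x n + cyl_len x n)%R) /\
  ((cyl_lo x n <= u < cyl_lo x n + cyl_len x n)%R ->
   (run n u).2 = ((u - cyl_lo x n) / cyl_len x n)%R).
Proof.
move=> u01; have pi1 := @probability_setT _ _ _ pi.
elim: n => [|n [IHY IHV]].
  have q_slot := quantileE pi1 (x 0%N) u01.
  split => [|/= ux].
    split => [/(_ 0%N isT)/q_slot|ux j]; first by rewrite /slot /= in_itv.
    rewrite leqn0 => /eqP -> /=; apply/q_slot.
    by rewrite /slot /= in_itv.
  have /q_slot ux' : slot pi (x 0%N) u by rewrite /slot /= in_itv.
  by rewrite /residue ux'.
have [lo0 len0 _] := cyl_bounds x n.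
rewrite /=; set lo := cyl_lo x n in IHY IHV lo0 *.
set len := cyl_len x n in IHY IHV len0 *.
have K1 := @prob_kernel _ _ _ _ _ K (x n).
have l0 := lower_ge0 (K (x n)) (x n.+1).
have m0 := mass_ge0 (K (x n)) (x n.+1).
have e1 := slot_end_le1 K1 (x n.+1).
set l := lower _ _ in l0 e1 *; set m := mass _ _ in m0 e1 *.
have widen : (lo + len * l <= u < lo + len * l + len * m)%R ->
    (lo <= u < lo + len)%R.
  move=> /andP[lu um]; rewrite (le_trans _ lu) ?lerDl ?mulr_ge0//=.
  by rewrite (lt_le_trans um)// -addrA -mulrDr lerD2l ler_piMr.
(* A half-open interval containing [u] has positive length, so the rescaling can be inverted. *)
have step : (lo <= u < lo + len)%R ->
    [/\ (0 < len)%R, (run n u).1 = x n,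
     (u = lo + len * (run n u).2)%R & (0 <= (run n u).2 < 1)%R].
  move=> /[dup] /IHY Y /[dup] /IHV -> /andP[lou ulo].
  have len_gt0 : (0 < len)%R by rewrite -(ltrD2l lo) addr0 (le_lt_trans lou).
  split => //; first exact: Y.
    by rewrite mulrC divfK ?gt_eqF// addrC subrK.
  by rewrite divr_ge0 ?subr_ge0//= ltr_pdivrMr// mul1r ltrBlDl.
have slot_shift : (lo <= u < lo + len)%R ->
  slot (K (x n)) (x n.+1) (run n u).2 <->
  (lo + len * l <= u < lo + len * l + len * m)%R.
  move=> /step[len_gt0 _ uE _]; rewrite /slot /= in_itv /= -/l -/m.
  rewrite -(ler_pM2l len_gt0) -(ltr_pM2l len_gt0) -(lerD2l lo) -(ltrD2l lo).
  by rewrite mulrDr addrA -uE.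
have runE : (lo <= u < lo + len)%R -> run n.+1 u =
    (quantile (K (x n)) (run n u).2, residue (K (x n)) (run n u).2).
  by move=> /step[_ + _ _] /=; case: (run n u) => s v /= ->.
split; first split.
- move=> Y; have I : (lo <= u < lo + len)%R.
    by apply/IHY => j jn; apply: Y; exact: leqW.
  apply/(slot_shift I)/(quantileE K1); first by have [] := step I.
  by have := Y _ (leqnn _); rewrite runE.
- move=> /[dup] /widen I II j; rewrite leq_eqVlt => /predU1P[->|jn].
    rewrite runE//=; apply/(quantileE K1); first by have [] := step I.
    exact/slot_shift.
  by have /IHY := I; apply.
- move=> /[dup] /widen I II; rewrite -/(run n.+1 u) runE//=.
  have qx : quantile (K (x n)) (run n u).2 = x n.+1.
    apply/(quantileE K1); first by have [] := step I.
    exact/slot_shift.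
  rewrite /residue qx -/l -/m; have [len_gt0 _ uE _] := step I.
  rewrite [in RHS]uE opprD addrACA subrr add0r -mulrBr invfM mulrACA.
  by rewrite divff ?gt_eqF// mul1r.
Qed.

Lemma measurable_run_state n :
  measurable_fun [set: measurableTypeR R] (fun u => (run n u).1).
Proof.
move=> _ A mA; rewrite setTI (bigcup_fibers (fun u => (run n u).1) (_ @^-1` _)).
apply: countable_bigcupT_measurable => // t.
have [At|nAt] := pselect (A t).
  have := measurable_run n t (@measurableT _ R); congr (measurable _).
  by apply/seteqP; split=> u /= [] => [-> //|? ->].
rewrite (_ : _ `&` _ = set0); first exact: measurable0.
by apply/seteqP; split => // u /= [+ ut]; rewrite ut.
Qed.

Definition run_state (n : nat) : {mfun (measurableTypeR R) >-> S} :=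
  HB.pack (fun u : measurableTypeR R => (run n u).1)
    (isMeasurableFun.Build _ _ _ _ _ (measurable_run_state n)).

Definition chain_var (n : nat) : {RV (uniform_prob (@ltr01 R)) >-> S} :=
  run_state n.

Lemma prob_run_cylinder x n :
  uniform_prob (@ltr01 R) [set u | forall j, (j <= n)%N -> chain_var j u = x j] =
  (cyl_len x n)%:E.
Proof.
have [lo0 len0 le1] := cyl_bounds x n.
pose U : probability (measurableTypeR R) R := uniform_prob (@ltr01 R).
have mC := @measurable_cylinder R _ _ S_discrete _ _ U chain_var n x.
have mI : measurable (`[0%R, 1%R[ : set (measurableTypeR R)).
  exact: measurable_itv.
(* Seeds outside [[0, 1[], where junk values occur, form a null set. *)
have U01 : U (~` `[0%R, 1%R[) = 0.
  rewrite probability_setC// (_ : U _ = 1) ?subee//.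
  by rewrite -[X in `[_, X[]add0r; apply: uniform_prob_itvco; rewrite ?add0r.
rewrite -(uniform_prob_itvco lo0 len0 le1) -/U [LHS](measureDI U mC mI).
rewrite [X in X + _](_ : _ = 0) ?add0e; last first.
  apply: subset_measure0 U01; [exact: measurableD|exact: measurableC|].
  by move=> u [].
congr (U _); apply/seteqP; split => u /=; rewrite !in_itv /=.
  by move=> [Y u01]; have [YI _] := run_cylinder x n u01; exact/YI.
move=> /[dup] I /andP[lou ulo].
have u01 : (0 <= u < 1)%R by rewrite (le_trans lo0 lou) (lt_le_trans ulo le1).
by have [YI _] := run_cylinder x n u01; split => //; exact/YI.
Qed.

Lemma chain_var_markov : markov_chain K chain_var.
Proof.
move=> n x; rewrite [LHS](prob_run_cylinder x n.+1).
rewrite [X in X * _](prob_run_cylinder x n) /= EFinM; congr (_ * _).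
exact: EFin_transition.
Qed.

Lemma chain_var_law : has_law (chain_var 0%N) pi.
Proof.
move=> A mA.
rewrite [LHS](measure_esum S_countable S_discrete).
rewrite [RHS](measure_esum S_countable S_discrete).
apply: eq_esum => x _.
transitivity ((cyl_len (fun=> x) 0)%:E); last first.
  by rewrite /= fineK// fin_num_measure.
rewrite -prob_run_cylinder; congr (uniform_prob (@ltr01 R) _).
apply/seteqP; split => u /= h; last exact: (h 0%N isT).
by move=> j; rewrite leqn0 => /eqP ->.
Qed.

End chain.
End quantile.

(** * Detailed balance from reversibility *)

Lemma exists_markov_chain (R : realType) dS (S : measurableType dS)
    (S_countable : countable [set: S])
    (S_discrete : forall A : set S, measurable A)
    (K : R.-pker S ~> S) (pi : probability S R) :
  exists X : nat -> {RV (uniform_prob (@ltr01 R)) >-> S},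
    markov_chain K X /\ has_law (X 0%N) pi.
Proof.
have /countable_injP[e e_inj0] := S_countable.
have e_inj : injective e by move=> x y; apply: e_inj0; rewrite inE.
(* [S] is inhabited because [pi] has mass one; any state can serve as junk value. *)
have [s0 _] : [set: S] !=set0.
  apply/set0P/eqP => S0; have := @probability_setT _ _ _ pi.
  by rewrite S0 measure0 => /eqP; rewrite eqe eq_sym oner_eq0.
exists (chain_var S_discrete e_inj s0 pi K S_countable); split.
  exact: chain_var_markov.
exact: chain_var_law.
Qed.

(** For a chain started from [pi], the two sides are the probabilities that its first two states are
    [x, y] and [y, x], which reversal exchanges. *)
Lemma reversible_balance (R : realType) dS (S : measurableType dS)
    (S_countable : countable [set: S])
    (S_discrete : forall A : set S, measurable A)
    (K : R.-pker S ~> S) (pi : probability S R) : reversible K pi ->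
  forall x y, pi [set x] * K x [set y] = pi [set y] * K y [set x].
Proof.
move=> K_rev x y.
have [X [X_markov X0]] := exists_markov_chain S_countable S_discrete K pi.
have two_steps a b : pi [set a] * K a [set b] =
    uniform_prob (@ltr01 R) [set u | [:: a; b] = segment X 0 1 u].
  pose z j := if j is 0%N then a else b.
  transitivity (uniform_prob (@ltr01 R)
      [set u | forall j, (j <= 1)%N -> X j u = z j]).
    rewrite X_markov -X0//; congr (_ * _); congr (uniform_prob (@ltr01 R) _).
    apply/seteqP; split => u /= h; last exact: (h 0%N isT).
    by move=> j; rewrite leqn0 => /eqP ->.
  congr (uniform_prob (@ltr01 R) _); apply/seteqP; split => u; rewrite /segment /=.
    by move=> h; rewrite (h 0%N)// (h 1%N).
  by move=> [aE bE] [|[|//]] _; rewrite /z ?aE ?bE.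
rewrite two_steps (K_rev _ _ _ _ X_markov X0 0%N 1%N (eq [:: x; y])) two_steps.
congr (uniform_prob (@ltr01 R) _); apply/seteqP; split => u;
  by rewrite /segment /rev /= => -[-> ->].
Qed.

(** * The outlier bound *)

(** The index [0] always satisfies the comparison, whence the successor. *)
Lemma outlier_count (R : realType) (S : Type) (omega : S -> R) (eps : R) k
    (x : nat -> S) :
  outlier eps (fun i : 'I_k.+1 => omega (x i)) <->
  ((count (fun z => omega z <= omega (x 0%N))
     [seq x j | j <- iota 1 k]).+1%:R <= eps * k.+1%:R)%R.
Proof.
rewrite /outlier; set n := #|_|; set c := count _ _.
suff -> : n = c.+1 by [].
have -> : c.+1 = count (fun z => omega z <= omega (x 0%N))%R
    [seq x j | j <- iota 0 k.+1] by rewrite /= lexx.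
by rewrite count_map -val_enum_ord count_map /n cardE size_filter -enumT.
Qed.

Unset Implicit Arguments.

Theorem corollaryS8p1 (R : realType) (dS : measure_display)
    (S : measurableType dS)
    (S_countable : countable [set: S])
    (S_discrete : forall A : set S, measurable A)
    (K : R.-pker S ~> S) (pi : probability S R)
    (pi_stationary : stationary K pi) (K_reversible : reversible K pi)
    (dT : measure_display) (T : measurableType dT) (P : probability T R)
    (X : nat -> {RV P >-> S}) (X_markov : markov_chain K X)
    (rho : probability S R) (X0_rho : has_law (X 0%N) rho)
    (omega : S -> R) (eps eps1 : R) (eps_gt0 : (0 < eps)%R)
    (eps1_ge0 : (0 <= eps1)%R) (rho_pi : tv_dist rho pi <= eps1%:E)
    (k : nat) :
  P [set w | outlier eps (fun i : 'I_k.+1 => omega (X i w))]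
    <= (Num.sqrt (2 * eps) + eps1)%:E.
Proof.
pose low x (r : seq S) : bool :=
  ((count (fun z => omega z <= omega x) r).+1%:R <= eps * k.+1%:R)%R.
(* Segments are never empty, so the value on [[::]] is a default. *)
pose A (s : seq S) := if s is x :: r then low x r else false.
have -> : [set w | outlier eps (fun i : 'I_k.+1 => omega (X i w))] =
    [set w | A (segment X 0 k w)].
  by apply/seteqP; split => w; apply outlier_count with (x := X ^~ w).
have step_ge0 := transition_ge0 K.
have step_mass x : \esum_(y in [set: S]) (transition K x y)%:E <= 1.
  under eq_esum do rewrite (EFin_transition S_discrete).
  by rewrite -(measure_esum S_countable S_discrete (K x)) prob_kernel.
rewrite (markov_segment S_countable S_discrete X_markov k A X0_rho).
pose f x := path_sum (transition K) k x (fun r => (low x r)%:R%:E).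
have f01 x : 0 <= f x <= 1.
  rewrite path_sum_ge0/=; [|exact: step_ge0|by move=> r; rewrite lee_fin].
  apply: le_trans (path_sum_cst step_ge0 step_mass k x ler01).
  by apply: le_path_sum => // r _; rewrite lee_fin lern1 leq_b1.
(* [f x] is the outlier probability from the initial state [x]; exchanging [rho] for [pi] costs at
   most [eps1] and leaves the stationary bound. *)
apply: (le_trans (le_esum_tv S_countable S_discrete rho_pi f01)).
rewrite EFinD leeD2r//.
have piE x : pi [set x] = (fine (pi [set x]))%:E.
  by rewrite fineK// fin_num_measure.
under eq_esum do rewrite piE.
apply: (outlier_path_sum step_ge0 step_mass _ _ _ omega k eps_gt0).
- by move=> x; rewrite fine_ge0// measure_ge0.
- under eq_esum do rewrite -piE.
  by rewrite -(measure_esum S_countable S_discrete pi); exact: probability_le1.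
- move=> x y; apply: EFin_inj; rewrite !EFinM -!piE !(EFin_transition S_discrete).
  exact: reversible_balance.
Qed.
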